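(* For every integer $n\ge 3$, let $\mathcal{B}_n$ be the bipartite graph with partite sets $\{u_0,u_1,\dots,u_n\}$ and $\{v_0,v_1,\dots,v_n\}$ and edge set $$E(\mathcal{B}_n)=\{u_0v_1,u_0v_2,u_0v_3\}\cup\{v_0u_1,v_0u_2,v_0u_3\}\cup\{u_iv_j : i,j\in\{1,\dots,n\}\}.$$ Then $\mathcal{B}_n$ is PMH but not 2FH. Moreover, the vertices $u_0$ and $v_0$ are 3-malleable.
   Context: A $2$-factor of a graph is a $2$-regular spanning subgraph (not necessarily connected), a Hamiltonian cycle is a connected $2$-factor, and a perfect matching is the edge set of a $1$-regular spanning subgraph. A Hamiltonian cycle $H$ extends a perfect matching $M$ if $M\subseteq E(H)$. A graph is 2FH (2-factor Hamiltonian) if it has a Hamiltonian cycle and each of its $2$-factors is a Hamiltonian cycle. A graph admitting a perfect matching is PMH if every one of its perfect matchings can be extended to a Hamiltonian cycle. For a vertex $v$, $\partial v$ denotes the set of edges incident to $v$. If $G$ admits a perfect matching and $v$ is a vertex of degree $t\ge 2$, then $v$ is $t$-malleable if for every perfect matching $M$ of $G$ there exist Hamiltonian cycles $H_1,\dots,H_{t-1}$ of $G$, all extending $M$, such that $\partial v - M\subset \bigcup_{i=1}^{t-1}E(H_i)$. *)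

(* Defs.v *)
From mathcomp Require Import all_boot.
Set Implicit Arguments.
Unset Strict Implicit.
Unset Printing Implicit Defensive.

Record sgraph := SGraph {
  vertex :> finType;
  adj : rel vertex;
  adj_sym : symmetric adj;
  adj_irr : irreflexive adj
}.

Section Graphs.
Variable G : sgraph.

(* An edge is an unordered pair, encoded as a two-element set of vertices.
   A spanning subgraph of G is identified with its edge set F \subset edges. *)
Definition edges : {set {set G}} :=
  [set e | [exists x, [exists y, adj x y && (e == [set x; y])]]].

Definition incident (F : {set {set G}}) (v : G) : {set {set G}} :=
  [set e in F | v \in e].

Definition degree (F : {set {set G}}) (v : G) : nat := #|incident F v|.

Definition spanning_regular (k : nat) (F : {set {set G}}) : Prop :=
  F \subset edges /\ forall v, degree F v = k.

Definition two_factor (F : {set {set G}}) : Prop := spanning_regular 2 F.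

Definition perfect_matching (M : {set {set G}}) : Prop := spanning_regular 1 M.

(* Connectedness of the spanning subgraph (V(G), F); the graph without
   vertices does not count as connected. *)
Definition connected (F : {set {set G}}) : Prop :=
  0 < #|G| /\ forall x y : G, connect [rel a b | [set a; b] \in F] x y.

Definition hamiltonian_cycle (H : {set {set G}}) : Prop :=
  two_factor H /\ connected H.

Definition extends (H M : {set {set G}}) : Prop := M \subset H.

Definition is_2FH : Prop :=
  (exists H, hamiltonian_cycle H) /\
  (forall F, two_factor F -> hamiltonian_cycle F).

Definition is_PMH : Prop :=
  (exists M, perfect_matching M) /\
  (forall M, perfect_matching M ->
     exists H, hamiltonian_cycle H /\ extends H M).

Definition malleable (t : nat) (v : G) : Prop :=
  [/\ exists M, perfect_matching M,
      degree edges v = t,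
      2 <= t
    & forall M, perfect_matching M ->
        exists H : 'I_t.-1 -> {set {set G}},
          (forall i, hamiltonian_cycle (H i) /\ extends (H i) M) /\
          incident edges v :\: M \subset \bigcup_(i < t.-1) H i].

End Graphs.

(* [Bn_uv i j] holds iff u_i v_j is an edge of B_n. The vertices u_i and v_i
   are [inl i] and [inr i]. The graph is the intended one for 3 <= n only. *)
Definition Bn_uv (n : nat) (i j : 'I_n.+1) : bool :=
  [|| (i == 0 :> nat) && (1 <= j <= 3),
      (j == 0 :> nat) && (1 <= i <= 3)
    | (1 <= i) && (1 <= j)].

Definition Bn_adj (n : nat) : rel ('I_n.+1 + 'I_n.+1) := fun x y =>
  match x, y with
  | inl i, inr j => Bn_uv i j
  | inr j, inl i => Bn_uv i j
  | _, _ => false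
  end.

Lemma Bn_adj_sym n : symmetric (@Bn_adj n).
Proof. by case=> i [] j. Qed.

Lemma Bn_adj_irr n : irreflexive (@Bn_adj n).
Proof. by case. Qed.

Definition Bn (n : nat) : sgraph := SGraph (@Bn_adj_sym n) (@Bn_adj_irr n).

Definition Bn_u (n : nat) (i : 'I_n.+1) : Bn n := inl i.
Definition Bn_v (n : nat) (i : 'I_n.+1) : Bn n := inr i.

(* Main.v *)
(* Identify a perfect matching of [Bn n] with the permutation p such that u_i is
   matched to v_(p i), and contract its edges: the Hamiltonian cycles through
   it become the Hamiltonian cycles of a digraph on {0, ..., n} in which all
   arcs are present except that 0 has only two out-neighbours and b = p^-1 0
   only two in-neighbours.  For any such neighbours k and i, the cycle
   0 -> k -> i -> b -> (all other vertices) -> 0 (with k and i merged if equal)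
   is Hamiltonian, so any edge at u_0 and any edge at v_0 outside the matching
   lie on a common Hamiltonian cycle extending it. *)

Require Import Defs.
From mathcomp Require Import all_boot.
From mathcomp Require Import perm zify.

Set Implicit Arguments.
Unset Strict Implicit.
Unset Printing Implicit Defensive.

(** * Malleability in arbitrary graphs *)

Lemma degree_diff (G : sgraph) (M : {set {set G}}) (v : G) :
  perfect_matching M ->
  #|incident (edges G) v :\: M| = (degree (edges G) v).-1.
Proof.
move=> [MG Mdeg].
have IM : incident (edges G) v :&: M = incident M v.
  apply/setP=> e; rewrite !inE; case: (boolP (e \in M)) => eM; rewrite ?andbF //.
  by have := subsetP MG _ eM; rewrite inE => ->; rewrite andbT.
by rewrite cardsD IM -subn1 -(Mdeg v).
Qed.

(** A perfect matching takes exactly one edge at [v], so $t-1$ others remain. This is also the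
    number of cycles that malleability allows, so one cycle through each remaining edge suffices;
    the enumeration of these edges indexes the cycles. *)
Lemma malleable_by_edges (G : sgraph) (v : G) (t : nat) :
  (exists M : {set {set G}}, perfect_matching M) ->
  degree (edges G) v = t -> 2 <= t ->
  (forall (M : {set {set G}}) e, perfect_matching M ->
     e \in incident (edges G) v :\: M ->
     exists H, [/\ hamiltonian_cycle H, extends H M & e \in H]) ->
  malleable t v.
Proof.
move=> exM dv t2 HM; split=> // M pmM.
have cD := degree_diff v pmM; rewrite dv in cD.
set D := _ :\: M in cD *.
have /fin_all_exists [H HP] (i : 'I_t.-1) : exists H,
    [/\ hamiltonian_cycle H, extends H M & enum_val (cast_ord (esym cD) i) \in H].
  by apply: HM => //; apply: enum_valP.
exists H; split=> [i|]; first by case: (HP i).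
apply/subsetP=> e eD; apply/bigcupP.
exists (cast_ord cD (enum_rank_in eD e)) => //.
by case: (HP (cast_ord cD (enum_rank_in eD e))); rewrite cast_ordK enum_rankK_in.
Qed.

(** As $t\ge 2$, the family of $t-1$ cycles is nonempty, and its first member already extends the
    matching. *)
Lemma malleable_PMH (G : sgraph) (v : G) (t : nat) : malleable t v -> is_PMH G.
Proof.
move=> [exM _ t2 HM]; split=> // M /HM [H [HP _]].
have t0 : 0 < t.-1 by lia.
by exists (H (Ordinal t0)).
Qed.

(** * Edges of $B_n$ *)

Section BnGraph.
Variable n : nat.
Implicit Types (i j : 'I_n.+1) (p q : {perm 'I_n.+1}).

Definition uv i j : {set Bn n} := [set Bn_u i; Bn_v j].

Lemma in_uv_u i j k : (Bn_u k \in uv i j) = (k == i).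
Proof. by rewrite !inE orbF. Qed.

Lemma in_uv_v i j k : (Bn_v k \in uv i j) = (k == j).
Proof. by rewrite !inE. Qed.

Lemma uv_inj i j i' j' : uv i j = uv i' j' -> i = i' /\ j = j'.
Proof.
move=> E; split; apply/eqP; first by rewrite -(in_uv_u i' j') -E in_uv_u.
by rewrite -(in_uv_v i' j') -E in_uv_v.
Qed.

Lemma uv_eq i j i' j' : (uv i j == uv i' j') = (i == i') && (j == j').
Proof.
apply/eqP/andP=> [/uv_inj [-> ->] //|[/eqP -> /eqP -> //]].
Qed.

Lemma edgeP (e : {set Bn n}) :
  reflect (exists i j, e = uv i j /\ Bn_uv i j) (e \in edges (Bn n)).
Proof.
rewrite inE; apply: (iffP idP).
  case/existsP=> x /existsP [y /andP [a /eqP ->]].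
  case: x y a => [i|i] [j|j] //= a; first by exists i, j.
  by exists j, i; split=> //; rewrite /uv setUC.
case=> i [j [-> a]]; apply/existsP; exists (Bn_u i); apply/existsP.
by exists (Bn_v j); rewrite /= a /=.
Qed.

Lemma uv_edge i j : (uv i j \in edges (Bn n)) = Bn_uv i j.
Proof.
apply/edgeP/idP=> [[i' [j' [/uv_inj [-> ->]]]] //|a].
by exists i, j.
Qed.

Lemma incident_edges_u i :
  incident (edges (Bn n)) (Bn_u i) = [set uv i j | j in [pred j | Bn_uv i j]].
Proof.
apply/setP=> e; rewrite inE; apply/andP/imsetP.
  by case=> /edgeP [i' [j [-> a]]]; rewrite in_uv_u => /eqP E; subst i'; exists j.
by case=> j /= a ->; rewrite uv_edge in_uv_u; split.
Qed.

Lemma incident_edges_v j :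
  incident (edges (Bn n)) (Bn_v j) = [set uv i j | i in [pred i | Bn_uv i j]].
Proof.
apply/setP=> e; rewrite inE; apply/andP/imsetP.
  by case=> /edgeP [i [j' [-> a]]]; rewrite in_uv_v => /eqP E; subst j'; exists i.
by case=> i /= a ->; rewrite uv_edge in_uv_v; split.
Qed.

(** * Perfect matchings as permutations *)

Definition compatible p := forall i, Bn_uv i (p i).

Definition perm_edges p : {set {set Bn n}} := [set uv i (p i) | i in 'I_n.+1].

Lemma uv_perm_edges p i j : (uv i j \in perm_edges p) = (p i == j).
Proof.
apply/imsetP/eqP=> [[k _ /uv_inj [-> ->]] //|<-].
by exists i.
Qed.

Lemma perm_edges_sub p : compatible p -> perm_edges p \subset edges (Bn n).
Proof. by move=> cp; apply/subsetP=> e /imsetP [i _ ->]; rewrite uv_edge. Qed.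

Lemma incident_perm_u p i : incident (perm_edges p) (Bn_u i) = [set uv i (p i)].
Proof.
apply/setP=> e; rewrite !inE; apply/andP/eqP=> [[/imsetP [k _ ->]]|->].
  by rewrite in_uv_u => /eqP ->.
by rewrite uv_perm_edges in_uv_u.
Qed.

Lemma incident_perm_v p i :
  incident (perm_edges p) (Bn_v (p i)) = [set uv i (p i)].
Proof.
apply/setP=> e; rewrite !inE; apply/andP/eqP=> [[/imsetP [k _ ->]]|->].
  by rewrite in_uv_v => /eqP /perm_inj ->.
by rewrite uv_perm_edges in_uv_v.
Qed.

Lemma perm_edges_matching p : compatible p -> perfect_matching (perm_edges p).
Proof.
move=> cp; split; first exact: perm_edges_sub.
case=> [i|j]; rewrite /degree; first by rewrite incident_perm_u cards1.
by rewrite -(permKV p j) incident_perm_v cards1.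
Qed.

(** Degree one at each $u_i$ gives a partner map [f], and degree one at each $v_j$ makes it
    injective, hence a permutation of the finite index set. *)
Lemma matching_perm (M : {set {set Bn n}}) : perfect_matching M ->
  exists p, compatible p /\ M = perm_edges p.
Proof.
move=> [MG Mdeg].
have inc1 v e : e \in M -> v \in e -> incident M v = [set e].
  move=> eM ve; have /eqP/cards1P [e' E] := Mdeg v; rewrite E; congr [set _].
  by apply/esym/set1P; rewrite -E inE eM ve.
have /fin_all_exists [f fP] i : exists j, uv i j \in M.
  have /eqP/cards1P [e E] := Mdeg (Bn_u i).
  have : e \in incident M (Bn_u i) by rewrite E set11.
  rewrite inE => /andP [eM ie].
  have /edgeP [k [j [Ee _]]] := subsetP MG _ eM.
  by move: ie; rewrite Ee in_uv_u => /eqP ->; exists j; rewrite -Ee.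
have f_inj : injective f.
  move=> i i' E.
  have := inc1 (Bn_v (f i)) _ (fP i); rewrite in_uv_v => /(_ (eqxx _)) E1.
  have := inc1 (Bn_v (f i)) _ (fP i'); rewrite in_uv_v E => /(_ (eqxx _)) E2.
  by move: E2; rewrite -E E1 => /set1_inj/uv_inj [].
exists (perm f_inj); split=> [i|].
  by rewrite permE -uv_edge (subsetP MG).
apply/eqP; rewrite eqEsubset; apply/andP; split; apply/subsetP=> e; last first.
  by case/imsetP=> i _ ->; rewrite permE.
move=> eM; have /edgeP [i [j [Ee _]]] := subsetP MG _ eM.
have := inc1 (Bn_u i) _ (fP i); rewrite in_uv_u => /(_ (eqxx _)) E.
have : e \in incident M (Bn_u i) by rewrite inE eM Ee in_uv_u eqxx.
by rewrite E => /set1P ->; rewrite uv_perm_edges permE.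
Qed.

(** * Hamiltonian cycles from pairs of permutations *)

Lemma incidentU (A B : {set {set Bn n}}) v :
  incident (A :|: B) v = incident A v :|: incident B v.
Proof. by apply/setP=> e; rewrite !inE andb_orl. Qed.

Lemma perm_edges_two_factor p q : compatible p -> compatible q ->
  (forall i, p i != q i) -> two_factor (perm_edges p :|: perm_edges q).
Proof.
move=> cp cq pq; split; first by rewrite subUset !perm_edges_sub.
case=> [i|j]; rewrite /degree incidentU.
  by rewrite !incident_perm_u cards2 uv_eq (negbTE (pq i)) andbF.
rewrite -{1}(permKV p j) -(permKV q j) !incident_perm_v cards2 !permKV uv_eq eqxx.
rewrite andbT; case: eqP => // E.
by have := pq (p^-1%g j); rewrite permKV E permKV eqxx.
Qed.

(** The walk $u_i$, $v_{q(i)} = v_{p(f(i))}$, $u_{f(i)}$ uses one edge of each matching. Hence an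
    orbit of [f] lies in one component, and the single orbit assumed here joins all $u_i$; each
    $v_j$ hangs on its [p]-partner. *)
Lemma perm_edges_connected p q (f : 'I_n.+1 -> 'I_n.+1) :
  (forall i, q i = p (f i)) -> (forall i j, fconnect f i j) ->
  connected (perm_edges p :|: perm_edges q).
Proof.
move=> qE cf; split; first by apply/card_gt0P; exists (Bn_u ord0).
set F := _ :|: _; set r := [rel a b | _].
have r_sym : connect_sym r.
  by apply: sym_connect_sym => x y; rewrite /= setUC.
have rp i : connect r (Bn_u i) (Bn_v (p i)).
  by apply: connect1; rewrite /= in_setU uv_perm_edges eqxx.
have rq i : connect r (Bn_u i) (Bn_v (q i)).
  by apply: connect1; rewrite /= in_setU !uv_perm_edges eqxx orbT.
have ruu i j : connect r (Bn_u i) (Bn_u j).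
  have /connectP [s ps ->] := cf i j.
  elim: s i ps => [|k s IH] i //= /andP [/eqP <- /IH]; apply: connect_trans.
  by apply: connect_trans (rq i) _; rewrite qE r_sym.
have rx x : connect r (Bn_u ord0) x.
  case: x => [i|j]; first exact: ruu.
  by apply: connect_trans (ruu _ (p^-1%g j)) _; have := rp (p^-1%g j); rewrite permKV.
by move=> x y; apply: connect_trans (rx y); rewrite r_sym.
Qed.

(** The list [s] is a Hamiltonian cycle of the contracted digraph, where an arc from $i$ to $j$
    stands for the edge $u_i v_{p(j)}$. Its arcs form a second perfect matching [q], disjoint from
    the first because arcs are not loops. *)
Lemma cycle_extends p (s : seq 'I_n.+1) :
  compatible p -> uniq s -> (forall i, i \in s) ->
  cycle (fun i j => (i != j) && Bn_uv i (p j)) s ->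
  exists H, [/\ hamiltonian_cycle H, extends H (perm_edges p)
               & forall i, uv i (p (next s i)) \in H].
Proof.
move=> cp us ins cs.
have arc i := next_cycle cs (ins i).
have next_inj : injective (next s) by apply: can_inj (prev_next us).
pose q := (perm next_inj * p)%g.
have qE i : q i = p (next s i) by rewrite permM permE.
exists (perm_edges p :|: perm_edges q); split; last 1 first.
- by move=> i; rewrite in_setU !uv_perm_edges qE eqxx orbT.
- split.
    apply: perm_edges_two_factor => // i; rewrite qE.
      by case/andP: (arc i).
    by rewrite (inj_eq perm_inj); case/andP: (arc i).
  apply: perm_edges_connected qE _ => i j.
  by rewrite (fconnect_cycle (cycle_next us) (ins i)).
- exact: subsetUl.
Qed.

(** * A Hamiltonian cycle through prescribed edges at $u_0$ and $v_0$ *)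

Lemma Bn_uv_pos i j : i != ord0 -> j != ord0 -> Bn_uv i j.
Proof. by rewrite -!val_eqE /= /Bn_uv => *; lia. Qed.

Lemma hamiltonian_through (M : {set {set Bn n}}) i j :
  perfect_matching M -> Bn_uv ord0 j -> Bn_uv i ord0 ->
  uv ord0 j \notin M -> uv i ord0 \notin M ->
  exists H, [/\ hamiltonian_cycle H, extends H M,
               uv ord0 j \in H & uv i ord0 \in H].
Proof.
move=> /matching_perm [p [cp ->]] a0j ai0; rewrite !uv_perm_edges => p0j pi0.
(* In the contracted digraph the edge $u_0v_j$ is the arc from 0 to [k], and $u_iv_0$ is the arc
   from [i] to [b]. *)
pose b := p^-1%g ord0; pose k := p^-1%g j.
have pb : p b = ord0 by rewrite permKV.
have pk : p k = j by rewrite permKV.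
(* [j0], [i0] and [b0] hold because $u_0v_0$ is not an edge; [k0] and [ib] because the prescribed
   edges lie outside the matching. *)
have j0 : j != ord0 by apply: contraTneq a0j => ->.
have i0 : i != ord0 by apply: contraTneq ai0 => ->.
have b0 : b != ord0 by apply: contraTneq (cp b) => E; rewrite pb E.
have k0 : k != ord0 by apply: contraNneq p0j => <-; rewrite pk.
have kb : k != b by apply: contraNneq j0 => E; rewrite -pk E pb.
have ib : i != b by apply: contraNneq pi0 => ->; rewrite pb.
pose e : rel 'I_n.+1 := fun x y => (x != y) && Bn_uv x (p y).
(* Only arcs that leave 0 or enter [b] can be missing. *)
have eP x y : x != ord0 -> y != b -> x != y -> e x y.
  move=> x0 yb xy; rewrite /e xy /=; apply: Bn_uv_pos => //.
  by apply: contraNneq yb => E; rewrite -(permK p y) E.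
(* The segment between 0 and [b]; if [k] and [i] coincide, the vertex is listed once to keep the
   cycle simple. *)
pose t := if k == i then [:: i] else [:: k; i].
pose r := [seq x <- enum 'I_n.+1 | x \notin ord0 :: rcons t b].
have lt : last ord0 t = i by rewrite /t; case: eqP.
have tP x : x \in t -> (x != ord0) && (x != b).
  rewrite /t; case: eqP => _; rewrite !inE.
    by move/eqP ->; rewrite i0.
  by case/orP=> /eqP ->; rewrite ?k0 ?i0.
have rP x : x \in r = (x \notin ord0 :: rcons t b).
  by rewrite mem_filter mem_enum andbT.
have ut : uniq (ord0 :: rcons t b).
  rewrite /= rcons_uniq mem_rcons inE negb_or eq_sym b0 /=.
  apply/and3P; split.
  - by apply/negP=> /tP; rewrite eqxx.
  - by apply/negP=> /tP; rewrite eqxx andbF.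
  - by rewrite /t; case: eqP => //= /eqP; rewrite inE => ->.
pose s := (ord0 :: rcons t b) ++ r.
have us : uniq s.
  rewrite cat_uniq ut filter_uniq ?enum_uniq // andbT /=.
  by apply/hasPn=> x; rewrite rP.
have ins x : x \in s by rewrite mem_cat rP orbN.
have r0b x : x \in r -> (x != ord0) && (x != b).
  by rewrite rP inE mem_rcons inE !negb_or => /and3P [-> ->].
have et : path e ord0 (rcons t b).
  have e0k : e ord0 k by rewrite /e eq_sym k0 pk a0j.
  have eib : e i b by rewrite /e ib pb ai0.
  rewrite rcons_path lt eib andbT /t; case: eqP => [<-|/eqP ki] /=.
    by rewrite andbT.
  by rewrite e0k eP.
have er : path e b (rcons r ord0).
  (* Since [b] comes first and 0 last, no earlier vertex is 0 and no later one is [b]. So every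
     ordered pair of this list is an arc, not just the consecutive ones, and the order of [r] is
     irrelevant. *)
  apply: (@pairwise_sorted _ e (b :: rcons r ord0)).
  rewrite /= pairwise_rcons; apply/and3P; split.
  - apply/allP=> x; rewrite mem_rcons inE => /orP [/eqP ->|/r0b /andP [x0 xb]].
      by apply: eP; rewrite // eq_sym.
    by apply: eP; rewrite // eq_sym.
  - by apply/allP=> x /r0b /andP [x0 xb]; apply: eP; rewrite // eq_sym.
  - have : uniq r by rewrite filter_uniq ?enum_uniq.
    rewrite uniq_pairwise; apply: (@sub_in_pairwise _ [in r]) (allss r) => x y.
    by move=> /r0b /andP [x0 _] /r0b /andP [_ yb]; apply: eP.
have cs : cycle e s by rewrite /= rcons_cat cat_path et last_rcons.
have [H [hH eH inH]] := cycle_extends cp us ins cs.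
exists H; split=> //.
  have := inH ord0; suff -> : next s ord0 = k by rewrite pk.
  by rewrite /s /t; case: eqP => [<-|_].
have := inH i; suff -> : next s i = b by rewrite pb.
rewrite /s /t; case: eqP => [_|/eqP ki] /=; rewrite ?(negbTE i0) ?eqxx //.
by rewrite eq_sym (negbTE ki).
Qed.

(** * Malleability of $u_0$ and $v_0$ *)

Lemma matching_exists : 3 <= n -> exists M : {set {set Bn n}}, perfect_matching M.
Proof.
(* The matching $u_0v_1$, $u_1v_0$ and $u_iv_i$ for $i\ge 2$; the identity fails only at
   $u_0v_0$. *)
move=> hn; exists (perm_edges (tperm ord0 (inord 1))); apply: perm_edges_matching.
move=> i; case: tpermP => [->|->|/eqP i0 _]; last exact: Bn_uv_pos.
all: by rewrite /Bn_uv /= inordK; lia.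
Qed.

Lemma card_nbr : 3 <= n -> #|[pred j : 'I_n.+1 | 0 < j <= 3]| = 3.
Proof.
move=> hn; rewrite -[RHS](size_iota 1 3) -(size_map (@inord n)).
rewrite -(card_uniqP _) //=; last by rewrite !inE -!val_eqE /= !inordK //; lia.
by apply: eq_card => j; rewrite !inE -!val_eqE /= !inordK //; lia.
Qed.

Lemma degree_u0 : 3 <= n -> degree (edges (Bn n)) (Bn_u ord0) = 3.
Proof.
move=> hn; rewrite /degree incident_edges_u card_imset => [|j j' /uv_inj [] //].
rewrite -[RHS](card_nbr hn); apply: eq_card => j.
by rewrite !inE /Bn_uv /= andbF !orbF.
Qed.

Lemma degree_v0 : 3 <= n -> degree (edges (Bn n)) (Bn_v ord0) = 3.
Proof.
move=> hn; rewrite /degree incident_edges_v card_imset => [|i i' /uv_inj [] //].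
rewrite -[RHS](card_nbr hn); apply: eq_card => i.
by rewrite !inE /Bn_uv /= !andbF orbF.
Qed.

(** Two of the three edges at [v] avoid the matching. When only one of $u_0$, $v_0$ has a prescribed
    edge, this supplies an arbitrary one at the other. *)
Lemma free_edge (M : {set {set Bn n}}) v : perfect_matching M ->
  degree (edges (Bn n)) v = 3 -> exists e, e \in incident (edges (Bn n)) v :\: M.
Proof.
move=> pmM dv; apply/set0Pn; rewrite -card_gt0.
by rewrite (degree_diff v pmM) dv.
Qed.

Lemma hamiltonian_through_edges (M : {set {set Bn n}}) e e' :
  perfect_matching M ->
  e \in incident (edges (Bn n)) (Bn_u ord0) :\: M ->
  e' \in incident (edges (Bn n)) (Bn_v ord0) :\: M ->
  exists H, [/\ hamiltonian_cycle H, extends H M, e \in H & e' \in H].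
Proof.
rewrite incident_edges_u incident_edges_v => pmM.
rewrite !inE => /andP [eM /imsetP [j aj Ee]] /andP [e'M /imsetP [i ai Ee']].
by subst e e'; apply: hamiltonian_through.
Qed.

Lemma malleable_u0 : 3 <= n -> malleable 3 (@Bn_u n ord0).
Proof.
move=> hn; apply: malleable_by_edges; rewrite ?degree_u0 //.
  exact: matching_exists.
move=> M e pmM eD; have [e' e'D] := free_edge pmM (degree_v0 hn).
by have [H [? ? ? _]] := hamiltonian_through_edges pmM eD e'D; exists H.
Qed.

Lemma malleable_v0 : 3 <= n -> malleable 3 (@Bn_v n ord0).
Proof.
move=> hn; apply: malleable_by_edges; rewrite ?degree_v0 //.
  exact: matching_exists.
move=> M e pmM eD; have [e' e'D] := free_edge pmM (degree_u0 hn).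
by have [H [? ? _ ?]] := hamiltonian_through_edges pmM e'D eD; exists H.
Qed.

(** * Failure of the 2FH property *)

(* The cycle [u_0 v_1 u_1 v_2] and the cycle
   [v_0 u_2 v_n u_n v_(n-1) u_(n-1) ... v_4 u_4 v_3 u_3] form a disconnected 2-factor. *)
Lemma Bn_not_2FH : 3 <= n -> ~ is_2FH (Bn n).
Proof.
move=> hn [_ H2].
(* [f] and [g] are the two perfect matchings formed by alternate edges of both cycles: [f] contains
   $u_0v_1$, $u_1v_2$, $u_2v_0$ and $u_iv_i$ for $i\ge 3$; [g] contains $u_0v_2$, $u_1v_1$,
   $u_2v_n$, $u_3v_0$ and $u_iv_{i-1}$ for $i\ge 4$. *)
pose f (i : 'I_n.+1) := if i < 2 then i.+1 else if i == 2 :> nat then 0 else i : nat.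
pose g (i : 'I_n.+1) := if i < 2 then 2 - i else
  if i == 2 :> nat then n else if i == 3 :> nat then 0 else i.-1.
have fn i : f i < n.+1 by have := ltn_ord i; rewrite /f; do !case: ifP => ?; lia.
have gn i : g i < n.+1 by have := ltn_ord i; rewrite /g; do !case: ifP => ?; lia.
have f_inj : injective (fun i => inord (f i) : 'I_n.+1).
  move=> i j /(congr1 val); rewrite /= !inordK // => E; apply: val_inj => /=.
  by move: E; rewrite /f; do !case: ifP => ?; lia.
have g_inj : injective (fun i => inord (g i) : 'I_n.+1).
  move=> i j /(congr1 val); rewrite /= !inordK // => E; apply: val_inj => /=.
  by have := ltn_ord i; have := ltn_ord j; move: E; rewrite /g; do !case: ifP => ?; lia.
pose p := perm f_inj; pose q := perm g_inj.
have pE i : p i = f i :> nat by rewrite permE inordK.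
have qE i : q i = g i :> nat by rewrite permE inordK.
have F2 : two_factor (perm_edges p :|: perm_edges q).
  apply: perm_edges_two_factor => i.
  - by rewrite /Bn_uv pE /f; do !case: ifP => ?; lia.
  - by rewrite /Bn_uv qE /g; have := ltn_ord i; do !case: ifP => ?; lia.
  - by rewrite -val_eqE /= pE qE /f /g; have := ltn_ord i; do !case: ifP => ?; lia.
have [_ [_ cF]] := H2 _ F2.
(* The vertex set of the 4-cycle. No edge of the 2-factor leaves it, and it contains $u_0$ but not
   $u_2$, which contradicts connectedness. *)
pose S (x : Bn n) := match x with inl i => i < 2 | inr j => 0 < j <= 2 end.
have SF i j : uv i j \in perm_edges p :|: perm_edges q ->
    S (Bn_u i) = S (Bn_v j).
  rewrite in_setU !uv_perm_edges /S => /orP [] /eqP <-.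
    by rewrite /= pE /f; do !case: ifP => ?; lia.
  by rewrite /= qE /g; have := ltn_ord i; do !case: ifP => ?; lia.
have clS : closed [rel a b | [set a; b] \in perm_edges p :|: perm_edges q] S.
  move=> x y /= xyF.
  have /edgeP [i [j [E _]]] : [set x; y] \in edges (Bn n).
    by have [[FG _] _] := H2 _ F2; apply: (subsetP FG).
  move: xyF; rewrite E => /SF.
  have := set21 x y; have := set22 x y; rewrite E => /set2P [] -> /set2P [] -> //.
have := closed_connect clS (cF (Bn_u ord0) (Bn_u (inord 2))).
by rewrite !unfold_in /= inordK //; lia.
Qed.

End BnGraph.

Theorem proposition2p7 (n : nat) (hn : 3 <= n) :
  [/\ is_PMH (Bn n),
      ~ is_2FH (Bn n),
      malleable 3 (Bn_u (@ord0 n))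
    & malleable 3 (Bn_v (@ord0 n))].
Proof.
split.
- exact: malleable_PMH (malleable_u0 hn).
- exact: Bn_not_2FH.
- exact: malleable_u0.
- exact: malleable_v0.
Qed.
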